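(* Let $x_0,x_1,\dots,x_m\in\mathbb{R}^n$, let $t\in\{1,\dots,n\}$, and let the interpolation set $\mathcal{X}=\{x_1,\dots,x_m\}$ undergo a $t$-axis flip, producing $\hat x_1,\dots,\hat x_m$. Let $W$ and $\widehat W$ be the KKT matrices of the original and flipped sets (both with base point $x_0$), and let $k=m+1+t$. Then the perturbation $\Delta W=\widehat W-W$ has rank at most two, is confined to the $k$-th row and column, and satisfies $\Delta W=e_kw_k^\top+w_ke_k^\top$, where $e_k$ is the $k$-th standard basis vector of $\mathbb{R}^{m+n+1}$ and the perturbation vector $w_k\in\mathbb{R}^{m+n+1}$ is $$(w_k)_i=(\hat x_i-x_0)^{(t)}-(x_i-x_0)^{(t)}=-2(x_i-x_0)^{(t)}\quad(i=1,\dots,m),$$ $$(w_k)_{m+1}=0,\qquad (w_k)_{m+1+j}=0\quad(j=1,\dots,n).$$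
   Context: $v^{(t)}$ denotes the $t$-th coordinate of $v\in\mathbb{R}^n$. The $t$-axis flip (about the base point $x_0$) negates the $t$-th shifted coordinate of every interpolation point and leaves the others unchanged: $(\hat x_i-x_0)^{(t)}=-(x_i-x_0)^{(t)}$ and $(\hat x_i-x_0)^{(j)}=(x_i-x_0)^{(j)}$ for $j\ne t$. Here $n+2\le m\le\frac12(n+1)(n+2)$. The KKT matrix of points $x_1,\dots,x_m$ with base point $x_0$ is $$W=\begin{pmatrix}A & X^\top \\ X & 0\end{pmatrix}\in\mathbb{R}^{(m+n+1)\times(m+n+1)},\qquad A_{ij}=\tfrac12\langle x_i-x_0,x_j-x_0\rangle^2,$$ where $X\in\mathbb{R}^{(n+1)\times m}$ has $i$-th column $(1,(x_i-x_0)^\top)^\top$. *)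

(* Defs.v *)
From mathcomp Require Import all_boot all_order all_algebra.
From mathcomp Require Import reals.

Set Implicit Arguments.
Unset Strict Implicit.
Unset Printing Implicit Defensive.

Import Order.TTheory GRing.Theory Num.Theory.
Local Open Scope ring_scope.

(* Points of R^n are column vectors. An interpolation set {x_1, ..., x_m} is the
   indexed family [x : 'I_m -> 'cV[R]_n], since the KKT matrix depends on the
   order of the points. All indices are 0-based. *)

Definition inner (R : realType) (n : nat) (u v : 'cV[R]_n) : R :=
  \sum_(j < n) u j 0 * v j 0.

Definition is_axis_flip (R : realType) (n m : nat) (t : 'I_n)
    (x0 : 'cV[R]_n) (x xhat : 'I_m -> 'cV[R]_n) : Prop :=
  forall i : 'I_m,
    (xhat i - x0) t 0 = - (x i - x0) t 0 /\
    (forall j : 'I_n, j != t -> (xhat i - x0) j 0 = (x i - x0) j 0).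

Definition kktA (R : realType) (n m : nat) (x0 : 'cV[R]_n)
    (x : 'I_m -> 'cV[R]_n) : 'M[R]_m :=
  \matrix_(i < m, j < m) (2^-1 * inner (x i - x0) (x j - x0) ^+ 2).

Definition kktX (R : realType) (n m : nat) (x0 : 'cV[R]_n)
    (x : 'I_m -> 'cV[R]_n) : 'M[R]_(1 + n, m) :=
  col_mx (const_mx 1) (\matrix_(j < n, i < m) (x i - x0) j 0).

Definition kkt (R : realType) (n m : nat) (x0 : 'cV[R]_n)
    (x : 'I_m -> 'cV[R]_n) : 'M[R]_(m + (1 + n)) :=
  block_mx (kktA x0 x) (kktX x0 x)^T (kktX x0 x) 0.

(* With 0-based t this is m + 1 + t, i.e. the 1-based position m + 1 + (t + 1). *)
Definition flip_index (n : nat) (m : nat) (t : 'I_n) : 'I_(m + (1 + n)) :=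
  rshift m (rshift 1 t).

(* Main.v *)
Require Import Defs.
From mathcomp Require Import all_boot all_order all_algebra.
From mathcomp Require Import reals.

(** Reflecting every displacement in the same coordinate is an isometry, so
    the inner products of displacements, and with them the block [A] of the
    KKT matrix, do not change ([kktA_axis_flip]). In the block [X] the flip
    alters only the row of coordinate [t], so the change of [X] is an outer
    product [e *m d^T], where [e] is a standard basis vector and [d] collects
    the changes of the flipped coordinates ([kktX_axis_flip]). Since [X] occurs
    once below the diagonal and once, transposed, above it, padding [e] and [d]
    with zeros gives vectors [e_k] and [w] for which the change of the whole
    matrix is [e_k *m w^T + w *m e_k^T]. The bound on the rank and the shape of
    the support hold for every matrix of this form. *)

Set Implicit Arguments.
Unset Strict Implicit.
Unset Printing Implicit Defensive.

Import Order.TTheory GRing.Theory Num.Theory.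
Local Open Scope ring_scope.

Lemma inner_axis_flip (R : realType) (n m : nat) (t : 'I_n)
    (x0 : 'cV[R]_n) (x xhat : 'I_m -> 'cV[R]_n) :
  is_axis_flip t x0 x xhat ->
  forall i j, inner (xhat i - x0) (xhat j - x0) = inner (x i - x0) (x j - x0).
Proof.
move=> flip i j; apply: eq_bigr => l _.
have [it ioff] := flip i; have [jt joff] := flip j.
by have [->|lNt] := eqVneq l t; [rewrite it jt mulrNN | rewrite ioff ?joff].
Qed.

Lemma kktA_axis_flip (R : realType) (n m : nat) (t : 'I_n)
    (x0 : 'cV[R]_n) (x xhat : 'I_m -> 'cV[R]_n) :
  is_axis_flip t x0 x xhat -> kktA x0 xhat = kktA x0 x.
Proof.
by move=> flip; apply/matrixP => i j; rewrite !mxE (inner_axis_flip flip).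
Qed.

Definition coord_change (R : realType) (n m : nat) (t : 'I_n)
    (x0 : 'cV[R]_n) (x xhat : 'I_m -> 'cV[R]_n) : 'cV[R]_m :=
  \col_i ((xhat i - x0) t 0 - (x i - x0) t 0).

(** The row of ones is unaffected, and so are the rows of the coordinates other
    than [t]; what remains is a single row. *)
Lemma kktX_axis_flip (R : realType) (n m : nat) (t : 'I_n)
    (x0 : 'cV[R]_n) (x xhat : 'I_m -> 'cV[R]_n) :
  is_axis_flip t x0 x xhat ->
  kktX x0 xhat - kktX x0 x =
    delta_mx (rshift 1 t) 0 *m (coord_change t x0 x xhat)^T.
Proof.
move=> flip; rewrite opp_col_mx add_col_mx subrr.
apply/matrixP => r i; rewrite [RHS]mxE big_ord1 [delta_mx _ _ _ _]mxE.
rewrite eqxx andbT [_^T _ _]mxE [coord_change _ _ _ _ _ _]mxE.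
case: (split_ordP r) => l ->.
  by rewrite col_mxEu eq_lrshift mul0r mxE.
have entry (y : 'I_m -> 'cV[R]_n) :
  (\matrix_(j < n, i < m) (y i - x0) j 0) l i = (y i - x0) l 0.
  by rewrite mxE.
rewrite col_mxEd eq_rshift [LHS]mxE [(- (\matrix_(_, _) _)) _ _]mxE !entry.
have [->|lNt] := eqVneq l t; first by rewrite mul1r.
by have [_ ->] := flip i; rewrite // subrr mul0r.
Qed.

Lemma mxrank_outer_sum (F : fieldType) (p q : nat)
    (u v : 'cV[F]_p) (y z : 'rV[F]_q) :
  (\rank (u *m y + v *m z)%R <= 2)%N.
Proof.
have outer1 (a : 'cV[F]_p) (b : 'rV[F]_q) : (\rank (a *m b) <= 1)%N.
  exact: leq_trans (mxrankM_maxl _ _) (rank_leq_col _).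
apply: leq_trans (mxrank_add _ _) _.
exact: (@leq_add _ _ 1 1).
Qed.

Lemma delta_outer_off (R : comPzRingType) (p : nat) (k : 'I_p) (w : 'cV[R]_p)
    (i j : 'I_p) :
  i != k -> j != k ->
  (delta_mx k 0 *m w^T + w *m (delta_mx k 0 : 'cV_p)^T) i j = 0.
Proof.
move=> /negPf iNk /negPf jNk.
by rewrite mxE !(mxE, big_ord1) iNk jNk mul0r mulr0 addr0.
Qed.

(** A pair of blocks [e *m d^T] and [d *m e^T] placed off the diagonal is the
    symmetrised outer product of the zero-padded vectors; transposition swaps
    the two factors, so both blocks come from the same two vectors. *)
Lemma block_outer_sym (R : comPzRingType) (p q : nat)
    (e : 'cV[R]_q) (d : 'cV[R]_p) :
  block_mx 0 (e *m d^T)^T (e *m d^T) 0 =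
    col_mx 0 e *m (col_mx d 0)^T + col_mx d 0 *m (col_mx 0 e)^T.
Proof.
rewrite !tr_col_mx !mul_col_row !trmx0 !mul0mx !mulmx0 add_block_mx.
by rewrite !addr0 !add0r trmx_mul trmxK.
Qed.

Lemma kkt_axis_flip (R : realType) (n m : nat) (t : 'I_n)
    (x0 : 'cV[R]_n) (x xhat : 'I_m -> 'cV[R]_n)
    (e_k := delta_mx (flip_index m t) 0 : 'cV[R]_(m + (1 + n)))
    (w := col_mx (coord_change t x0 x xhat) 0 : 'cV[R]_(m + (1 + n))) :
  is_axis_flip t x0 x xhat ->
  kkt x0 xhat - kkt x0 x = e_k *m w^T + w *m e_k^T.
Proof.
move=> flip.
have -> : e_k = col_mx 0 (delta_mx (rshift 1 t) 0).
  apply/matrixP => r c; rewrite ord1 mxE.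
  case: (split_ordP r) => l ->; first by rewrite col_mxEu eq_lrshift mxE.
  by rewrite col_mxEd eq_rshift mxE.
rewrite -block_outer_sym -(kktX_axis_flip flip) /kkt opp_block_mx add_block_mx.
by rewrite (kktA_axis_flip flip) !subrr linearB.
Qed.

Theorem theorem2p3 (R : realType) (n m : nat)
    (hm_lb : (n + 2 <= m)%N) (hm_ub : (m <= ((n + 1) * (n + 2)) %/ 2)%N)
    (x0 : 'cV[R]_n) (x xhat : 'I_m -> 'cV[R]_n) (t : 'I_n)
    (hflip : is_axis_flip t x0 x xhat) :
  let k : 'I_(m + (1 + n)) := flip_index m t in
  let e_k : 'cV[R]_(m + (1 + n)) := delta_mx k 0 in
  let DW : 'M[R]_(m + (1 + n)) := kkt x0 xhat - kkt x0 x in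
  [/\ (\rank DW <= 2)%N,
      (forall i j : 'I_(m + (1 + n)), i != k -> j != k -> DW i j = 0)
    & exists w : 'cV[R]_(m + (1 + n)),
      [/\ DW = e_k *m w^T + w *m e_k^T,
          (forall i : 'I_m,
             w (lshift (1 + n) i) 0 = (xhat i - x0) t 0 - (x i - x0) t 0 /\
             w (lshift (1 + n) i) 0 = - 2 * (x i - x0) t 0),
          w (rshift m (lshift n 0)) 0 = 0
        & forall j : 'I_n, w (rshift m (rshift 1 j)) 0 = 0]].
Proof.
move=> k e_k DW.
have DWE := kkt_axis_flip hflip; split.
- by rewrite /DW DWE mxrank_outer_sum.
- by move=> i j iNk jNk; rewrite /DW DWE delta_outer_off.
exists (col_mx (coord_change t x0 x xhat) 0); split=> //.
- move=> i; rewrite col_mxEu [coord_change _ _ _ _ _ _]mxE; split=> //.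
  by have [-> _] := hflip i; rewrite mulNr mulr_natl mulr2n opprD.
- by rewrite col_mxEd mxE.
- by move=> j; rewrite col_mxEd mxE.
Qed.
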